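(* Suppose the plant graph $G_{\mathcal P}$ contains no isolated node and at least one sink, and the control graph $G_{\mathcal K}$ is the complete graph (so $\mathcal K=\mathbb R^{n\times n}$). Then the competitive ratio of the communication-less design method $\Gamma^{\Theta}$ (defined in the context) is $$r_{\mathcal P}(\Gamma^{\Theta})=\begin{cases}1, & \text{if } (S_{\mathcal P})_{11}=0 \text{ and } (S_{\mathcal P})_{22}=0,\\ 1+1/\epsilon^2, & \text{otherwise.}\end{cases}$$
   Context: Fix integers $q\ge 1$ and $n_1,\dots,n_q\ge 1$, put $n=\sum_{i=1}^q n_i$, and fix a real $\epsilon>0$. Matrices $M\in\mathbb R^{n\times n}$ are partitioned into blocks $M_{ij}\in\mathbb R^{n_i\times n_j}$, $1\le i,j\le q$. Graphs are directed with vertex set $\{1,\dots,q\}$, possibly with self-loops. The adjacency matrix $S=(s_{ij})$ of $G=(\{1,\dots,q\},E)$ is $s_{ij}=1$ if $(j,i)\in E$ and $s_{ij}=0$ otherwise. A vertex $i$ is a sink if there is no $j\ne i$ with $(i,j)\in E$; it is isolated if there is no $j\ne i$ with $(i,j)\in E$ or $(j,i)\in E$. The complete graph contains all edges $(i,j)$, including self-loops. Plants: given the plant graph $G_{\mathcal P}$ with adjacency matrix $S_{\mathcal P}$, let $\mathcal A(S_{\mathcal P})=\{A\in\mathbb R^{n\times n}: A_{ij}=0 \text{ whenever } (s_{\mathcal P})_{ij}=0\}$, and let $\mathcal B(\epsilon)$ be the set of diagonal $n\times n$ matrices with all diagonal entries $\ge\epsilon$. The set of plants is $\mathcal P=\mathcal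 A(S_{\mathcal P})\times\mathcal B(\epsilon)\times\mathbb R^n$; $P=(A,B,x_0)$ stands for the system $x(k+1)=Ax(k)+Bu(k)$, $x(0)=x_0$. Controllers: given the control graph $G_{\mathcal K}$ with adjacency matrix $S_{\mathcal K}$, let $\mathcal K=\{K\in\mathbb R^{n\times n}: K_{ij}=0 \text{ whenever } (s_{\mathcal K})_{ij}=0\}$; $K$ acts by $u(k)=Kx(k)$. Cost: $J_P(K)=\sum_{k=1}^\infty x(k)^Tx(k)+\sum_{k=0}^\infty u(k)^Tu(k)\in[0,\infty]$, evaluated along the closed loop of $P$ with $u=Kx$. Competitive ratio: for each $P\in\mathcal P$ let $K^*(P)\in\mathcal K$ be an optimal controller, i.e. $J_P(K^*(P))\le J_P(K)$ for all $K\in\mathcal K$ (for complete $G_{\mathcal K}$ it exists: the linear quadratic regulator). For a control design method, i.e. a map $\Gamma:\mathcal A(S_{\mathcal P})\times\mathcal B(\epsilon)\to\mathcal K$, set $$r_{\mathcal P}(\Gamma)=\sup_{P=(A,B,x_0)\in\mathcal P}\frac{J_P(\Gamma(A,B))}{J_P(K^*(P))},$$ with the conventions $0/0=1$ and $c/0=\infty$ for $c>0$. Sinks: let $c\ge 1$ be the number of sinks of $G_{\mathcal P}$, with vertices numbered so that the sinks are exactly $q-c+1,\dots,q$. Then $S_{\mathcal P}=\begin{bmatrix}(S_{\mathcal P})_{11}&0\\(S_{\mathcal P})_{21}&(S_{\mathcal P})_{22}\end{bmatrix}$, where $(S_{\mathcal P})_{11}$ is the $(q-c)\times(q-c)$ submatrix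 on the non-sinks and $(S_{\mathcal P})_{22}$ is the $c\times c$ (necessarily diagonal) submatrix on the sinks. The method $\Gamma^{\Theta}$: for all $(A,B)$, $$\Gamma^{\Theta}(A,B)=-\mathrm{diag}\big(B_{11}^{-1},\dots,B_{q-c,q-c}^{-1},W_{q-c+1}(A,B),\dots,W_q(A,B)\big)A,$$ where for $q-c+1\le i\le q$, $W_i(A,B)=(I+B_{ii}^TX_{ii}B_{ii})^{-1}B_{ii}^TX_{ii}$ and $X_{ii}$ is the unique positive definite solution of $$A_{ii}^TX_{ii}B_{ii}(I+B_{ii}^TX_{ii}B_{ii})^{-1}B_{ii}^TX_{ii}A_{ii}-A_{ii}^TX_{ii}A_{ii}+X_{ii}-I=0.$$ Communication-less means that, for each $i$, the block row $i$ of the gain depends only on $[A_{i1}\ \cdots\ A_{iq}]$ and $B_{ii}$. *)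

(* Defs.v *)
From HB Require Import structures.
From mathcomp Require Import all_boot all_order all_algebra.
From mathcomp Require Import all_classical all_reals all_analysis.

Set Implicit Arguments.
Unset Strict Implicit.
Unset Printing Implicit Defensive.

Import Order.TTheory GRing.Theory Num.Theory.

Local Open Scope classical_set_scope.
Local Open Scope ring_scope.

Section Graphs.
Variables (q : nat) (e : rel 'I_q).

(* [e i j] means that (i, j) is an edge, from i to j. Mind the transposition:
   s_ij = 1 iff (j, i) is an edge. *)
Definition adjacency : 'M[nat]_q := \matrix_(i, j) nat_of_bool (e j i).

Definition sink (i : 'I_q) : bool := [forall j, (j != i) ==> ~~ e i j].

Definition isolated_vertex (i : 'I_q) : bool :=
  [forall j, (j != i) ==> ~~ e i j && ~~ e j i].

Definition complete_graph : Prop := forall i j, e i j.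

End Graphs.

Section Plants.
Variables (R : realType) (q : nat) (nb : 'I_q -> nat).

Local Notation n := (\sum_(i < q) nb i)%N.

Definition structured (S : 'M[nat]_q) (M : 'M[R]_n) : Prop :=
  forall i j, S i j = 0%N -> submxblock M i j = 0.

Definition input_matrix (eps : R) (B : 'M[R]_n) : Prop :=
  is_diag_mx B /\ forall i, eps <= B i i.

Record plant := Plant {
  plantA : 'M[R]_n;
  plantB : 'M[R]_n;
  plantx0 : 'cV[R]_n }.

Definition plants (S : 'M[nat]_q) (eps : R) : set plant :=
  [set P | structured S (plantA P) /\ input_matrix eps (plantB P)].

Fixpoint state (P : plant) (K : 'M[R]_n) (k : nat) : 'cV[R]_n :=
  if k is k'.+1 then
    plantA P *m state P K k' + plantB P *m (K *m state P K k')
  else plantx0 P.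

Definition input (P : plant) (K : 'M[R]_n) (k : nat) : 'cV[R]_n :=
  K *m state P K k.

Definition sqnorm k (v : 'cV[R]_k) : R := (v^T *m v) 0 0.

(* The state sum starts at k = 1, the input sum at k = 0. *)
Definition cost (P : plant) (K : 'M[R]_n) : \bar R :=
  (\sum_(1 <= k <oo) (sqnorm (state P K k))%:E
   + \sum_(0 <= k <oo) (sqnorm (input P K k))%:E)%E.

Definition optimal_controller (SK : 'M[nat]_q) (P : plant) (K : 'M[R]_n) :=
  structured SK K /\ forall K', structured SK K' -> (cost P K <= cost P K')%E.

(* A choice of optimal controller K*(P); the value [cost P (Kstar SK P)] does
   not depend on which one is chosen. The default 0 is only there for totality. *)
Definition Kstar (SK : 'M[nat]_q) (P : plant) : 'M[R]_n :=
  xget 0 [set K | optimal_controller SK P K].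

(* For a > 0, [a / 0 = +oo] already holds in [\bar R]; but [0 / 0 = 0] there. *)
Definition cost_ratio (a b : \bar R) : \bar R :=
  (if (a == 0) && (b == 0) then 1 else a / b)%E.

(* The domain of [G] is to be read as the pairs (A, B) of plants: the other
   values of [G] are irrelevant. *)
Definition competitive_ratio (SP SK : 'M[nat]_q) (eps : R)
    (G : 'M[R]_n -> 'M[R]_n -> 'M[R]_n) : \bar R :=
  ereal_sup [set cost_ratio (cost P (G (plantA P) (plantB P)))
                            (cost P (Kstar SK P)) | P in plants SP eps].

Definition communication_less (SP : 'M[nat]_q) (eps : R)
    (G : 'M[R]_n -> 'M[R]_n -> 'M[R]_n) : Prop :=
  forall A A' B B' : 'M[R]_n,
    structured SP A -> structured SP A' ->
    input_matrix eps B -> input_matrix eps B' ->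
  forall i, submxcol A i = submxcol A' i ->
    submxblock B i i = submxblock B' i i ->
    submxcol (G A B) i = submxcol (G A' B') i.

End Plants.

Section Riccati.
Variables (R : realType) (k : nat).

Definition posdef (X : 'M[R]_k) : Prop :=
  X^T = X /\ forall v : 'cV[R]_k, v != 0 -> 0 < (v^T *m X *m v) 0 0.

Definition riccati (A B X : 'M[R]_k) : Prop :=
  A^T *m X *m B *m invmx (1%:M + B^T *m X *m B) *m B^T *m X *m A
  - A^T *m X *m A + X - 1%:M = 0.

(* The positive definite solution, which exists and is unique when B is
   diagonal with positive diagonal. *)
Definition riccati_sol (A B : 'M[R]_k) : 'M[R]_k :=
  xget 0 [set X | posdef X /\ riccati A B X].

Definition riccati_gain (A B : 'M[R]_k) : 'M[R]_k :=
  let X := riccati_sol A B in invmx (1%:M + B^T *m X *m B) *m B^T *m X.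

End Riccati.

Section Theta.
Variables (R : realType) (m c : nat) (nb : 'I_(m + c) -> nat).

Local Notation n := (\sum_(i < m + c) nb i)%N.

(* The vertices i < m are the non-sinks, the last c ones are the sinks. *)
Definition Theta_block (A B : 'M[R]_n) (i : 'I_(m + c)) : 'M[R]_(nb i) :=
  if (i < m)%N then invmx (submxblock B i i)
  else riccati_gain (submxblock A i i) (submxblock B i i).

Definition Theta (A B : 'M[R]_n) : 'M[R]_n :=
  - (\mxdiag_(i < m + c) Theta_block A B i *m A).

Lemma Theta_communication_less (SP : 'M[nat]_(m + c)) (eps : R) :
  communication_less SP eps Theta.
Proof.
move=> A A' B B' _ _ _ _ i eqA eqB.
have rowE X Y : submxcol (Theta X Y) i = - (Theta_block X Y i *m submxcol X i).
  by rewrite /Theta submxcolN -[X in _ *m X]submxcolK mul_mxdiag_mxcol mxcolK.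
have eqAii : submxblock A i i = submxblock A' i i by rewrite !submxblockEv eqA.
by rewrite !rowE /Theta_block eqA eqB eqAii.
Qed.

End Theta.

(* Main.v *)
(* Write y = A x0. Any control satisfies
     J >= |u_0|^2 + |x_1|^2 >= sum_r y_r^2 / (1 + b_r^2).
   Gamma^Theta is deadbeat on the non-sinks, so from time 1 on the sinks evolve
   as independent subsystems, and its cost is the sum of |B_ii^-1 y_i|^2 over
   the non-sinks and of the LQR costs over the sinks. Each of the latter is at most
   the deadbeat cost |B_ii^-1 y_i|^2, hence the factor
     (1 + b^2) / b^2 <= 1 + 1/eps^2;
   when (S_P)_11 = 0 and (S_P)_22 = 0 both bounds coincide.
   The factor is approached with B = eps I: for an edge j -> i between non-sinks
   by A = h E_ij with h -> 0, and for a self-loop at a sink i, which some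
   non-sink j points to, by A = a E_ii + a^2 E_ij with a -> oo: Gamma^Theta then
   nearly cancels y_i, whereas a tiny input at j lets the optimal control bring
   the state to the kernel of A in one step. *)
Require Import Defs.
From mathcomp Require Import all_boot all_order all_algebra.
From mathcomp Require Import all_classical all_reals all_analysis.
From mathcomp Require Import ring lra.

Set Implicit Arguments.
Unset Strict Implicit.
Unset Printing Implicit Defensive.

Import Order.TTheory GRing.Theory Num.Theory.
Import numFieldNormedType.Exports.
Local Open Scope ring_scope.

(** * Quadratic forms and the Riccati equation *)

Section QuadraticForms.
Context {R : realType}.
Implicit Types k : nat.

Definition qform k (X : 'M[R]_k) (v : 'cV[R]_k) : R := (v^T *m X *m v) 0 0.

Lemma sqnormE k (v : 'cV[R]_k) : sqnorm v = \sum_i v i 0 ^+ 2.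
Proof. by rewrite /sqnorm mxE; apply: eq_bigr => i _; rewrite mxE expr2. Qed.

Lemma sqnorm_ge0 k (v : 'cV[R]_k) : 0 <= sqnorm v.
Proof. by rewrite sqnormE sumr_ge0 // => i _; rewrite sqr_ge0. Qed.

Lemma sqnorm0 k : sqnorm (0 : 'cV[R]_k) = 0.
Proof. by rewrite /sqnorm mulmx0 mxE. Qed.

Lemma sqnormN k (v : 'cV[R]_k) : sqnorm (- v) = sqnorm v.
Proof. by rewrite !sqnormE; apply: eq_bigr => i _; rewrite mxE sqrrN. Qed.

Lemma sqnormZ k (a : R) (v : 'cV[R]_k) : sqnorm (a *: v) = a ^+ 2 * sqnorm v.
Proof.
by rewrite !sqnormE mulr_sumr; apply: eq_bigr => i _; rewrite mxE exprMn.
Qed.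

Lemma sqnorm_gt0 k (v : 'cV[R]_k) : v != 0 -> 0 < sqnorm v.
Proof.
move=> v0; rewrite lt_neqAle sqnorm_ge0 andbT; apply: contra v0 => /eqP/esym.
rewrite sqnormE => /psumr_eq0P v0; apply/eqP/colP => i; rewrite mxE.
by apply/eqP; rewrite -sqrf_eq0; apply/eqP/v0 => // j _; rewrite sqr_ge0.
Qed.

Lemma qformD k (X Y : 'M[R]_k) v : qform (X + Y) v = qform X v + qform Y v.
Proof. by rewrite /qform mulmxDr mulmxDl mxE. Qed.

Lemma qform1 k (v : 'cV[R]_k) : qform 1%:M v = sqnorm v.
Proof. by rewrite /qform mulmx1. Qed.

Lemma qform_congr k l (A : 'M[R]_(k, l)) X v :
  qform (A^T *m X *m A) v = qform X (A *m v).
Proof. by rewrite /qform trmx_mul !mulmxA. Qed.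

Definition psd k (X : 'M[R]_k) : Prop :=
  X^T = X /\ forall v, 0 <= qform X v.

Lemma psd0 k : psd (0 : 'M[R]_k).
Proof. by split=> [|v]; rewrite ?trmx0 // /qform mulmx0 mul0mx mxE. Qed.

Lemma posdef_psd k (X : 'M[R]_k) : posdef X -> psd X.
Proof.
move=> [Xs Xp]; split=> // v; have [->|/Xp/ltW//] := eqVneq v 0.
by rewrite /qform mulmx0 mxE.
Qed.

Lemma psd_congr k l (A : 'M[R]_(k, l)) X : psd X -> psd (A^T *m X *m A).
Proof.
move=> [Xs Xp]; split=> [|v]; last by rewrite qform_congr.
by rewrite !trmx_mul trmxK Xs mulmxA.
Qed.

Lemma posdef1D k (X : 'M[R]_k) : psd X -> posdef (1%:M + X).
Proof.
move=> [Xs Xp]; split=> [|v v0]; first by rewrite linearD /= trmx1 Xs.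
by rewrite -/(qform _ v) qformD qform1 ltr_wpDr ?Xp ?sqnorm_gt0.
Qed.

Lemma posdef_unitmx k (X : 'M[R]_k) : posdef X -> X \in unitmx.
Proof.
move=> [_ Xp]; rewrite unitmxE unitfE; apply/det0P => -[v v0 vX].
have := Xp v^T; rewrite trmxK vX mul0mx mxE ltxx trmx_eq0 v0.
by move=> /(_ isT).
Qed.

End QuadraticForms.

(** * One step of dynamic programming *)

Section RiccatiStep.
Context {R : realType} {k : nat}.
Variable B : 'M[R]_k.
Implicit Types X Y : 'M[R]_k.

(** The formula of [riccati_gain] with X free, so that it serves the iterates as well as the Riccati
    solution. *)
Definition lqr_gain X := invmx (1%:M + B^T *m X *m B) *m B^T *m X.

(* [y^T (rstep X) y] is the minimum over [u] of [stage X y u]. *)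
Definition rstep X := X - X *m B *m lqr_gain X.

(** Here y = A x is the state before the input acts; X measures the cost from the next state on,
    that state included. *)
Definition stage X (y u : 'cV[R]_k) := sqnorm u + qform X (y + B *m u).

(** Completing the square in u: with M = I + B^T X B and W = [lqr_gain X], one has M W = B^T X and,
    by symmetry, W^T M = X B. *)
Lemma stage_square X y u : psd X ->
  stage X y u = qform (rstep X) y
                + qform (1%:M + B^T *m X *m B) (u + lqr_gain X *m y).
Proof.
move=> pX; have [Xs _] := pX.
have [Ms _] := posdef1D (psd_congr B pX).
have Mu := posdef_unitmx (posdef1D (psd_congr B pX)).
have MW : (1%:M + B^T *m X *m B) *m lqr_gain X = B^T *m X.
  by rewrite /lqr_gain !mulmxA mulmxV // mul1mx.
have WM : (lqr_gain X)^T *m (1%:M + B^T *m X *m B) = X *m B.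
  by rewrite -[_ *m _]trmxK trmx_mul trmxK Ms MW trmx_mul trmxK Xs.
rewrite /rstep; move: (lqr_gain X) MW WM => W MW WM.
have addE (P Q : 'M[R]_1) : (P + Q) 0 0 = P 0 0 + Q 0 0 by rewrite mxE.
have oppE (P : 'M[R]_1) : (- P) 0 0 = - P 0 0 by rewrite mxE.
rewrite /stage /qform /sqnorm.
have trD (P Q : 'cV[R]_k) : (P + Q)^T = P^T + Q^T by rewrite linearD.
have sqE (M : 'M[R]_k) : (u + W *m y)^T *m M *m (u + W *m y) =
  u^T *m M *m u + u^T *m (M *m W) *m y
  + y^T *m (W^T *m M) *m u + y^T *m (W^T *m M *m W) *m y.
  by rewrite trD trmx_mul !mulmxDl !mulmxDr !mulmxA !addrA.
rewrite sqE MW WM trD trmx_mul !mulmxDl !mulmxDr !mulmxDl !mulmxN !mulmx1.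
rewrite !mulNmx !mulmxA !addE !oppE; ring.
Qed.

Lemma rstep_le_stage X y u : psd X -> qform (rstep X) y <= stage X y u.
Proof.
by move=> pX; rewrite stage_square // lerDl (posdef_psd (posdef1D _)).2 //;
  apply: psd_congr.
Qed.

Lemma stage_gain X y : psd X ->
  stage X y (- (lqr_gain X *m y)) = qform (rstep X) y.
Proof.
by move=> pX; rewrite stage_square // addNr /qform mulmx0 [X in _ + X]mxE addr0.
Qed.

Lemma stage_ge0 X y u : psd X -> 0 <= stage X y u.
Proof. by move=> pX; rewrite addr_ge0 ?sqnorm_ge0 ?pX.2. Qed.

Lemma psd_rstep X : psd X -> psd (rstep X).
Proof.
move=> pX; split=> [|y]; last by rewrite -stage_gain // stage_ge0.
have [Xs _] := pX; have [Ms _] := posdef1D (psd_congr B pX).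
rewrite /rstep /lqr_gain linearB /= !trmx_mul trmxK trmx_inv Ms Xs.
by rewrite !mulmxA.
Qed.

(** The minimizing input for Y is fed to X, for which it is merely admissible. *)
Lemma le_rstep X Y : psd X -> psd Y -> (forall v, qform X v <= qform Y v) ->
  forall y, qform (rstep X) y <= qform (rstep Y) y.
Proof.
move=> pX pY XY y; apply: le_trans (rstep_le_stage y (- (lqr_gain Y *m y)) pX) _.
by rewrite -[leRHS]stage_gain // /stage lerD2l.
Qed.

(** The input -B^-1 y brings the state to 0, so only its own energy is paid. *)
Lemma rstep_le_deadbeat X y : B \in unitmx -> psd X ->
  qform (rstep X) y <= sqnorm (invmx B *m y).
Proof.
move=> Bu pX; apply: le_trans (rstep_le_stage y (- (invmx B *m y)) pX) _.
by rewrite /stage sqnormN mulmxN mulKVmx // subrr /qform mulmx0 [X in _ + X]mxE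
           addr0.
Qed.

(** Casts the Riccati equation as the fixed-point equation of value iteration. *)
Lemma riccatiP A X : riccati A B X <-> X = 1%:M + A^T *m rstep X *m A.
Proof.
rewrite /riccati /rstep /lqr_gain mulmxBr mulmxBl !mulmxA.
set P := _ *m invmx _ *m _ *m _ *m _; set Q := A^T *m X *m A.
split=> [/eqP|XE]; last by rewrite XE; apply/matrixP => i j; rewrite !mxE; ring.
rewrite subr_eq0 => /eqP XE; rewrite -[in X in X + _]XE.
by apply/matrixP => i j; rewrite !mxE; ring.
Qed.

End RiccatiStep.

(** * Entrywise limits of matrices *)

Section EntrywiseLimits.
Context {R : realType}.
Local Open Scope classical_set_scope.

Definition mx_cvg p q (U : nat -> 'M[R]_(p, q)) (X : 'M[R]_(p, q)) : Prop :=
  forall i j, U t i j @[t --> \oo] --> X i j.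

Lemma cvg_sumr (I : finType) (f : I -> nat -> R) (a : I -> R) :
  (forall i, f i t @[t --> \oo] --> a i) ->
  \sum_i f i t @[t --> \oo] --> \sum_i a i.
Proof.
by move=> fa; apply: cvg_big => [|i _]; [exact: add_continuous|exact: fa].
Qed.

Lemma cvg_prodr (I : finType) (f : I -> nat -> R) (a : I -> R) :
  (forall i, f i t @[t --> \oo] --> a i) ->
  \prod_i f i t @[t --> \oo] --> \prod_i a i.
Proof.
by move=> fa; apply: cvg_big => [|i _]; [exact: mul_continuous|exact: fa].
Qed.

Lemma mx_cvg_cst p q (X : 'M[R]_(p, q)) : mx_cvg (fun=> X) X.
Proof. by move=> i j; exact: cvg_cst. Qed.

Lemma mx_cvg_unique p q (U : nat -> 'M[R]_(p, q)) X Y :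
  mx_cvg U X -> mx_cvg U Y -> X = Y.
Proof.
by move=> UX UY; apply/matrixP => i j; apply: (cvg_unique _ (UX i j) (UY i j)).
Qed.

Lemma mx_cvgD p q (U V : nat -> 'M[R]_(p, q)) X Y :
  mx_cvg U X -> mx_cvg V Y -> mx_cvg (fun t => U t + V t) (X + Y).
Proof.
move=> UX VY i j; rewrite mxE; under eq_fun do rewrite mxE.
exact: (cvgD (UX i j) (VY i j)).
Qed.

Lemma mx_cvgN p q (U : nat -> 'M[R]_(p, q)) X :
  mx_cvg U X -> mx_cvg (fun t => - U t) (- X).
Proof.
move=> UX i j; rewrite mxE; under eq_fun do rewrite mxE.
exact: (cvgN (UX i j)).
Qed.

Lemma mx_cvgM p q r (U : nat -> 'M[R]_(p, q)) (V : nat -> 'M[R]_(q, r)) X Y :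
  mx_cvg U X -> mx_cvg V Y -> mx_cvg (fun t => U t *m V t) (X *m Y).
Proof.
move=> UX VY i j; rewrite mxE; under eq_fun do rewrite mxE.
by apply: cvg_sumr => l; exact: (cvgM (UX i l) (VY l j)).
Qed.

Lemma cvg_det p (U : nat -> 'M[R]_p) X :
  mx_cvg U X -> \det (U t) @[t --> \oo] --> \det X.
Proof.
move=> UX; apply: cvg_sumr => s; apply: cvgM; first exact: cvg_cst.
by apply: cvg_prodr => i; exact: UX.
Qed.

(** Cofactor formula: entries of the inverse are minors over the determinant, whose limit is
    nonzero. *)
Lemma mx_cvgV p (U : nat -> 'M[R]_p) X :
  (forall t, U t \in unitmx) -> X \in unitmx ->
  mx_cvg U X -> mx_cvg (fun t => invmx (U t)) (invmx X).
Proof.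
move=> Uu Xu UX i j; rewrite /invmx Xu; under eq_fun do rewrite Uu !mxE.
rewrite !mxE; apply: cvgM.
  by apply: cvgV (cvg_det UX); move: Xu; rewrite unitmxE unitfE.
apply: cvgM; first exact: cvg_cst.
by apply: cvg_det => a b; rewrite !mxE; under eq_fun do rewrite !mxE; exact: UX.
Qed.

Lemma cvg_qform p (U : nat -> 'M[R]_p) X v :
  mx_cvg U X -> qform (U t) v @[t --> \oo] --> qform X v.
Proof.
move=> UX.
have vU := mx_cvgM (mx_cvgM (@mx_cvg_cst _ _ v^T) UX) (@mx_cvg_cst _ _ v).
exact: (vU 0 0).
Qed.

Lemma qform_polarization p (X : 'M[R]_p) i j : X^T = X ->
  X i j = (qform X (delta_mx i 0 + delta_mx j 0) - qform X (delta_mx i 0)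
           - qform X (delta_mx j 0)) / 2.
Proof.
have E a b : ((delta_mx a 0 : 'cV_p)^T *m X *m (delta_mx b 0 : 'cV_p)) 0 0 = X a b.
  by rewrite -colE mxE trmx_delta -rowE mxE.
move=> Xs; have Xji : X j i = X i j by rewrite -[in LHS]Xs mxE.
have trD (P Q : 'cV[R]_p) : (P + Q)^T = P^T + Q^T by rewrite linearD.
have addE (P Q : 'M[R]_1) : (P + Q) 0 0 = P 0 0 + Q 0 0 by rewrite mxE.
by rewrite /qform trD !mulmxDl !mulmxDr !addE !E Xji; field.
Qed.

(** By polarization each entry is a fixed combination of three values of the form, and monotone
    convergence is available for such values. *)
Lemma is_mx_cvg_qform p (U : nat -> 'M[R]_p) :
  (forall t, (U t)^T = U t) -> (forall v, cvgn (fun t => qform (U t) v)) ->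
  exists X, mx_cvg U X.
Proof.
move=> Us Uv; exists (\matrix_(i, j) limn (fun t => U t i j)) => i j.
rewrite mxE; suff: cvgn (fun t => U t i j) by [].
under eq_fun do rewrite qform_polarization //.
by apply: is_cvgMr_tmp; do 2![apply: is_cvgB; last exact: Uv]; exact: Uv.
Qed.

End EntrywiseLimits.

(** * Value iteration and existence of a Riccati solution *)

Section RiccatiExistence.
Context {R : realType} {k : nat}.
Local Open Scope classical_set_scope.
Variables A B : 'M[R]_k.

(** Starting from 0, the form of the t-th iterate at x0 is the least sum of |x_s|^2 + |u_s|^2 over s
    < t. *)
Definition value_iter t := iter t (fun X => 1%:M + A^T *m rstep B X *m A) 0.

Lemma value_iterS t :
  value_iter t.+1 = 1%:M + A^T *m rstep B (value_iter t) *m A.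
Proof. by []. Qed.

Lemma psd_value_iter t : psd (value_iter t).
Proof.
elim: t => [|t IH]; first exact: psd0.
by apply/posdef_psd/posdef1D/psd_congr/psd_rstep.
Qed.

Lemma qform_value_iterS t v : qform (value_iter t.+1) v =
  sqnorm v + qform (rstep B (value_iter t)) (A *m v).
Proof. by rewrite value_iterS qformD qform1 qform_congr. Qed.

Lemma value_iter_nondecreasing v :
  {homo (fun t => qform (value_iter t) v) : s t / (s <= t)%N >-> s <= t}.
Proof.
apply: homo_leq => [//|x y z xy yz|t]; first exact: le_trans yz.
elim: t v => [|t IH] v.
  by rewrite /= {1}/qform mulmx0 mul0mx mxE (psd_value_iter 1).2.
by rewrite !qform_value_iterS lerD2l; apply: le_rstep => //; apply: psd_value_iter.
Qed.

(** Stopping the system in one step gives a bound independent of t; passing to t+1 exposes one step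
    of the recursion. *)
Lemma value_iter_bounded v t : B \in unitmx ->
  qform (value_iter t) v <= sqnorm v + sqnorm (invmx B *m (A *m v)).
Proof.
move=> Bu; apply: le_trans (value_iter_nondecreasing v (leqnSn t)) _.
rewrite qform_value_iterS lerD2l rstep_le_deadbeat //; exact: psd_value_iter.
Qed.

(** The iterates increase and stay bounded, so they converge. The convergence is kept in the
    conclusion because optimality is deduced from it. *)
Lemma riccati_exists : B \in unitmx ->
  exists X, [/\ posdef X, riccati A B X
    & forall v, qform (value_iter t) v @[t --> \oo] --> qform X v].
Proof.
move=> Bu; have [|v|X UX] := @is_mx_cvg_qform R k value_iter.
- by move=> t; have [] := psd_value_iter t.
- apply: nondecreasing_is_cvgn; first exact: value_iter_nondecreasing.
  by eexists => _ [t _ <-]; exact: value_iter_bounded.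
have pX : psd X.
  split=> [|v]; last first.
    apply: (cvgr_to_ge (cvg_qform (v:=v) UX)); near=> t.
    exact: (psd_value_iter t).2.
  apply: (@mx_cvg_unique _ _ _ value_iter) => // i j; rewrite mxE.
  under eq_fun do rewrite -(psd_value_iter _).1 mxE.
  exact: UX.
have pM (Y : 'M[R]_k) : psd Y -> 1%:M + B^T *m Y *m B \in unitmx.
  by move=> pY; apply/posdef_unitmx/posdef1D/psd_congr.
have XE : X = 1%:M + A^T *m rstep B X *m A.
  (* The shifted sequence tends to X and, by continuity of each operation in the step, to the
     right-hand side. *)
  apply: (@mx_cvg_unique _ _ _ (fun t => value_iter t.+1)).
    by move=> i j; rewrite (cvg_shiftS (fun t => value_iter t i j)); exact: UX.
  have cst := @mx_cvg_cst R k k.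
  apply: mx_cvgD; first exact: cst.
  apply: mx_cvgM; last exact: cst.
  apply: mx_cvgM; first exact: cst.
  apply: mx_cvgD; first exact: UX.
  apply: mx_cvgN; apply: mx_cvgM; first by apply: mx_cvgM; [exact: UX|exact: cst].
  apply: mx_cvgM; last exact: UX.
  apply: mx_cvgM; last exact: cst.
  apply: mx_cvgV => [t||]; [exact/pM/psd_value_iter|exact: pM|].
  apply: mx_cvgD; first exact: cst.
  apply: mx_cvgM; last exact: cst.
  by apply: mx_cvgM; [exact: cst|exact: UX].
exists X; split=> [||v]; last exact: cvg_qform.
- by rewrite XE; apply/posdef1D/psd_congr/psd_rstep.
- exact/riccatiP.
Unshelve. all: by end_near. Qed.

Lemma riccati_qform X v : riccati A B X ->
  qform X v = sqnorm v + qform (rstep B X) (A *m v).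
Proof. by move=> /riccatiP {1}->; rewrite qformD qform1 qform_congr. Qed.

Lemma riccati_solP : B \in unitmx ->
  posdef (riccati_sol A B) /\ riccati A B (riccati_sol A B).
Proof.
move=> Bu; apply: (@xgetPex _ _ [set X | posdef X /\ riccati A B X]).
by have [X [pX rX _]] := riccati_exists Bu; exists X.
Qed.

End RiccatiExistence.

(** * Cost, optimal controllers and cost ratios *)

Section Cost.
Context {R : realType} {q : nat} {nb : 'I_q -> nat}.
Local Notation n := (\sum_(i < q) nb i)%N.
Implicit Types (P : plant R nb) (K : 'M[R]_n).

Definition stage_cost P K t :=
  sqnorm (state P K t.+1) + sqnorm (input P K t).

Lemma stage_cost_ge0 P K t : 0 <= stage_cost P K t.
Proof. by rewrite addr_ge0 ?sqnorm_ge0. Qed.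

(** Pairs x(t+1) with u(t), so that both sums start at 0. *)
Lemma costE P K :
  cost P K = (\sum_(0 <= t <oo) (stage_cost P K t)%:E)%E.
Proof.
rewrite /cost -(@nneseries_addn _ _ 1); last by move=> i; rewrite lee_fin sqnorm_ge0.
under eq_eseriesr do rewrite addn1.
by rewrite -nneseriesD // => t _ _; rewrite lee_fin sqnorm_ge0.
Qed.

Lemma cost_ge_sum P K N : ((\sum_(t < N) stage_cost P K t)%:E <= cost P K)%E.
Proof.
rewrite costE -sumEFin -(big_mkord xpredT (fun t => (stage_cost P K t)%:E)).
by apply: nneseries_lim_ge => t _ _; rewrite lee_fin stage_cost_ge0.
Qed.

Lemma cost_ge0 P K : (0 <= cost P K)%E.
Proof. by have := cost_ge_sum P K 0; rewrite big_ord0. Qed.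

Lemma cost_le P K c :
  (forall N, \sum_(t < N) stage_cost P K t <= c) -> (cost P K <= c%:E)%E.
Proof.
move=> le_c; rewrite costE; apply: lime_le.
  by apply: is_cvg_nneseries => t _ _; rewrite lee_fin stage_cost_ge0.
by apply: nearW => N; rewrite big_mkord sumEFin lee_fin.
Qed.

Lemma state_shift P K t :
  state (Plant (plantA P) (plantB P) (state P K 1)) K t = state P K t.+1.
Proof. by elim: t => //= t ->. Qed.

Lemma stage_cost_shift P K t :
  stage_cost (Plant (plantA P) (plantB P) (state P K 1)) K t
  = stage_cost P K t.+1.
Proof. by rewrite /stage_cost /input !state_shift. Qed.

Definition closed_loop P K (x : 'cV[R]_n) :=
  plantA P *m x + plantB P *m (K *m x).

(** V pays for each stage: the costs so far plus the current V never exceed the initial V, which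
    bounds all partial sums. *)
Lemma cost_le_lyapunov P K (V : 'cV[R]_n -> R) :
  (forall x, 0 <= V x) ->
  (forall x, sqnorm (closed_loop P K x) + sqnorm (K *m x)
             + V (closed_loop P K x) <= V x) ->
  (cost P K <= (V (plantx0 P))%:E)%E.
Proof.
move=> V0 Vd; apply: cost_le => N.
suff: \sum_(t < N) stage_cost P K t + V (state P K N) <= V (plantx0 P).
  by apply: le_trans; rewrite lerDl.
elim: N => [|N IH]; first by rewrite big_ord0 add0r.
rewrite big_ord_recr /=; apply: le_trans IH; rewrite -addrA lerD2l.
exact: Vd.
Qed.

End Cost.

(** * One-step bounds for a diagonal input matrix *)

Section Diagonal.
Context {R : realType} {k : nat}.
Implicit Types (B : 'M[R]_k) (u y : 'cV[R]_k).

Lemma diag_mulmx B u i : is_diag_mx B -> (B *m u) i 0 = B i i * u i 0.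
Proof.
move=> /is_diag_mxP Bd; rewrite mxE (bigD1 i) //= big1 ?addr0 // => j ji.
by rewrite Bd ?mul0r // eq_sym.
Qed.

Lemma diag_unitmx B : is_diag_mx B -> (forall i, B i i != 0) -> B \in unitmx.
Proof.
move=> /diag_mxP[d ->] d0; rewrite unitmxE unitfE det_diag.
by apply/prodf_neq0 => i _; have := d0 i; rewrite !mxE eqxx.
Qed.

Lemma diag_invmx_mulmx B y i : is_diag_mx B -> (forall i, B i i != 0) ->
  (invmx B *m y) i 0 = y i 0 / B i i.
Proof.
move=> Bd B0; apply: (mulfI (B0 i)); rewrite -diag_mulmx //.
by rewrite mulmxA mulmxV ?diag_unitmx // mul1mx mulrCA divff ?mulr1.
Qed.

(** For diagonal B, the minimum over u of |y + B u|^2 + |u|^2, taken coordinate by coordinate. *)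
Definition one_step_cost B y := \sum_i y i 0 ^+ 2 / (1 + B i i ^+ 2).

Lemma one_step_cost_ge0 B y : 0 <= one_step_cost B y.
Proof. by apply: sumr_ge0 => i _; rewrite divr_ge0 ?addr_ge0 ?sqr_ge0. Qed.

Lemma one_step_cost_le B y u : is_diag_mx B ->
  one_step_cost B y <= sqnorm (y + B *m u) + sqnorm u.
Proof.
move=> Bd; rewrite !sqnormE -big_split /=; apply: ler_sum => i _.
rewrite mxE diag_mulmx // ler_pdivrMr ?ltr_wpDr ?sqr_ge0 //.
(* The gap times 1 + b^2 is exactly this square. *)
have := sqr_ge0 (u i 0 * (1 + B i i ^+ 2) + B i i * y i 0).
move: (y i 0) (u i 0) (B i i) => a b c h; rewrite -subr_ge0.
suff -> : ((a + c * b) ^+ 2 + b ^+ 2) * (1 + c ^+ 2) - a ^+ 2 =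
  (b * (1 + c ^+ 2) + c * a) ^+ 2 by exact: h.
by ring.
Qed.

(** In each coordinate the quotient of the two costs is 1 + 1/b^2, and b >= eps. *)
Lemma deadbeat_le B (eps : R) y : 0 < eps -> is_diag_mx B ->
  (forall i, eps <= B i i) ->
  sqnorm (invmx B *m y) <= (1 + 1 / eps ^+ 2) * one_step_cost B y.
Proof.
move=> e0 Bd Be; have B0 i : 0 < B i i by apply: lt_le_trans (Be i).
rewrite sqnormE mulr_sumr; apply: ler_sum => i _.
rewrite diag_invmx_mulmx //; last by move=> j; rewrite gt_eqF.
rewrite expr_div_n mulrCA ler_wpM2l ?sqr_ge0 //.
rewrite -[leLHS]mul1r ler_pdivrMr ?exprn_gt0 // mulrAC.
rewrite ler_pdivlMr ?ltr_wpDr ?sqr_ge0 // mul1r.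
have : 1 <= B i i ^+ 2 / eps ^+ 2.
  by rewrite ler_pdivlMr ?exprn_gt0 // mul1r lerXn2r ?nnegrE // ltW.
by rewrite mul1r mulrDl mul1r addrC lerD2l mulrC.
Qed.

End Diagonal.

(** * Optimality of the linear quadratic regulator *)

Section OptimalController.
Context {R : realType} {q : nat} {nb : 'I_q -> nat}.
Local Notation n := (\sum_(i < q) nb i)%N.
Implicit Types (P : plant R nb) (K : 'M[R]_n).

Lemma stage_cost0 P K : stage_cost P K 0 =
  sqnorm (plantA P *m plantx0 P + plantB P *m input P K 0)
  + sqnorm (input P K 0).
Proof. by []. Qed.

Lemma one_step_cost_le_stage P K t : is_diag_mx (plantB P) ->
  one_step_cost (plantB P) (plantA P *m state P K t) <= stage_cost P K t.
Proof. by move=> Bd; apply: one_step_cost_le. Qed.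

Lemma one_step_cost_le_cost P K : is_diag_mx (plantB P) ->
  ((one_step_cost (plantB P) (plantA P *m plantx0 P))%:E <= cost P K)%E.
Proof.
move=> Bd; apply: le_trans (cost_ge_sum P K 1); rewrite big_ord1 lee_fin.
exact: (@one_step_cost_le_stage P K 0).
Qed.

(** The induction is over all plants, because the tail of a trajectory is a trajectory of the plant
    restarted at x(1). *)
Lemma value_iter_le_sum P K N :
  qform (value_iter (plantA P) (plantB P) N) (plantx0 P)
  <= sqnorm (plantx0 P) + \sum_(t < N) stage_cost P K t.
Proof.
elim: N P => [|N IH] P.
  by rewrite big_ord0 addr0 /qform mulmx0 mul0mx mxE sqnorm_ge0.
rewrite qform_value_iterS lerD2l big_ord_recl.
apply: le_trans (rstep_le_stage _ _ (input P K 0) (psd_value_iter _ _ N)) _.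
have := IH (Plant (plantA P) (plantB P) (state P K 1)).
rewrite (eq_bigr _ (fun (t : 'I_N) _ => stage_cost_shift P K t)) /=.
by rewrite /stage stage_cost0 /input /=; lra.
Qed.

Lemma lqr_optimal P : plantB P \in unitmx ->
  exists K, forall K', (cost P K <= cost P K')%E.
Proof.
move=> Bu; have [X [/posdef_psd pX rX Xlim]] := riccati_exists (plantA P) Bu.
exists (- (lqr_gain (plantB P) X *m plantA P)) => K'.
(* V is the form of X minus |x|^2, since the cost leaves out the initial state. *)
pose V x := qform (rstep (plantB P) X) (plantA P *m x).
apply: (@le_trans _ _ (V (plantx0 P))%:E).
  apply: cost_le_lyapunov => [x|x]; first exact: (psd_rstep _ pX).2.
  rewrite addrAC -(riccati_qform _ rX) addrC.
  by rewrite /closed_loop mulNmx -mulmxA -/(stage _ _ _ _) stage_gain.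
have: (cost P K' != -oo)%E by rewrite gt_eqF // (lt_le_trans _ (cost_ge0 _ _)).
case EQ: (cost P K') => [c| |] // _; last by rewrite leey.
rewrite lee_fin -(lerD2l (sqnorm (plantx0 P))) -(riccati_qform _ rX).
(* Finite-horizon values stay below the cost of K' plus |x0|^2 and tend to the form of X at x0. *)
apply: cvgr_to_le (Xlim _) _; apply: nearW => N.
apply: le_trans (value_iter_le_sum P K' N) _.
by rewrite lerD2l -lee_fin -EQ cost_ge_sum.
Qed.

(** An optimum exists, so [xget] returns one instead of its default; completeness makes every gain
    admissible. *)
Lemma cost_Kstar_le (e : rel 'I_q) P K : complete_graph e ->
  plantB P \in unitmx -> (cost P (Kstar (adjacency e) P) <= cost P K)%E.
Proof.
move=> ec Bu; have es K' : structured (adjacency e) K'.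
  by move=> i j; rewrite mxE ec.
have [K0 K0opt] := lqr_optimal Bu.
have [] // := @xgetPex _ 0 [set K1 | optimal_controller (adjacency e) P K1].
  by exists K0.
by move=> _; apply.
Qed.

End OptimalController.

(** * Bounds on ratios of extended reals *)

Section Ratio.
Context {R : realType}.
Local Open Scope ereal_scope.

(** Degenerate cases: 0/0 counts as 1 <= C; b = 0 forces l = 0 and then a = 0; b = +oo gives ratio
    0. *)
Lemma cost_ratio_le (a b : \bar R) (C l : R) : (1 <= C)%R -> (0 <= l)%R ->
  0 <= a -> a <= (C * l)%:E -> l%:E <= b -> cost_ratio a b <= C%:E.
Proof.
move=> C1 l0 a0 aC lb; have C0 : (0 <= C)%R by apply: le_trans C1.
rewrite /cost_ratio; case: ifPn => [_|ab0]; first by rewrite lee_fin.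
have [b0|b0] := eqVneq b 0.
  move: ab0 lb aC; rewrite b0 eqxx andbT lee_fin => a_neq0 l_le0.
  have -> : l = 0%R by apply/eqP; rewrite eq_le l_le0.
  by rewrite mulr0 => a_le0; case/negP: a_neq0; rewrite eq_le a0 a_le0.
case: b lb b0 {ab0} => [b| |] // lb b0; last by rewrite invey mule0 lee_fin.
have {}b0 : (0 < b)%R by rewrite lt_neqAle eq_sym b0 (le_trans l0).
rewrite inver gt_eqF // lee_pdivrMr // (le_trans aC) // -EFinM lee_fin.
by rewrite ler_wpM2l.
Qed.

Lemma cost_ratio_ge (a b : \bar R) (lo hi : R) : (0 < lo)%R -> (0 < hi)%R ->
  lo%:E <= a -> 0 <= b -> b <= hi%:E -> (lo / hi)%:E <= cost_ratio a b.
Proof.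
move=> lo0 hi0 loa b0 bhi; have a0 : 0 < a by apply: lt_le_trans loa; rewrite lte_fin.
rewrite /cost_ratio gt_eqF //=.
have [->|b_neq0] := eqVneq b 0; first by rewrite inve0 gt0_muley ?leey.
case: b b0 bhi b_neq0 => [b| |] // b0 bhi b_neq0.
have {}b0 : (0 < b)%R by rewrite lt_neqAle eq_sym b_neq0.
rewrite inver gt_eqF // lee_pdivlMr // (le_trans _ loa) // -EFinM lee_fin.
by rewrite mulrAC ler_pdivrMr // ler_wpM2l // ltW.
Qed.

Lemma le_of_linear_error (S : \bar R) (C k : R) : (0 <= C)%R -> (0 < k)%R ->
  (forall h : R, (0 < h < 1)%R -> (C * (1 - k * h))%:E <= S) -> C%:E <= S.
Proof.
move=> C0 k0 CS; apply/lee_addgt0Pr => e e0.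
have Ck0 : (0 < C * k + 1)%R by rewrite ltr_wpDl // mulr_ge0 // ltW.
(* The first term keeps h below 1, the second makes the error C k h at most e; the added 1 keeps the
   denominator positive when C = 0. *)
pose h : R := Num.min (1 / 2)%R (e / (C * k + 1))%R.
have h0 : (0 < h < 1)%R.
  by rewrite /h lt_min gt_min divr_gt0 //= divr_gt0 // ltr_pdivrMr // mul1r ltr1n.
have he : (h * (C * k + 1) <= e)%R.
  by rewrite -ler_pdivlMr // /h ge_min lexx orbT.
apply: le_trans (_ : (C * (1 - k * h))%:E + e%:E <= _).
  rewrite -EFinD lee_fin; case/andP: h0 => h0 _; nra.
by rewrite leeD2r // CS.
Qed.

End Ratio.

(** * Upper bound for Gamma^Theta *)

Section Blocks.
Context {R : realType} {q : nat} {nb : 'I_q -> nat}.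
Local Notation n := (\sum_(i < q) nb i)%N.
Implicit Types (A B : 'M[R]_n) (x y u : 'cV[R]_n).

Lemma submxcol_mulmx A x i :
  submxcol (A *m x) i = \sum_j submxblock A i j *m submxcol x j.
Proof.
rewrite -submxcol_mul -[x in LHS]submxcolK -[submxcol A i]submxrowK.
by rewrite mul_mxrow_mxcol; apply: eq_bigr => j _; rewrite submxblockEv.
Qed.

Lemma sqnorm_submxcol x : sqnorm x = \sum_i sqnorm (submxcol x i).
Proof.
rewrite /sqnorm -{1 2}[x]submxcolK tr_mxcol mul_mxrow_mxcol summxE.
by [].
Qed.

Lemma diag_submxblock B i : is_diag_mx B -> is_diag_mx (submxblock B i i).
Proof. by rewrite -{1}[B]submxblockK => /is_diag_mxblockP[]. Qed.

Lemma submxcol_diag_mulmx B x i : is_diag_mx B ->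
  submxcol (B *m x) i = submxblock B i i *m submxcol x i.
Proof.
rewrite -{1}[B]submxblockK => /is_diag_mxblockP[Bd _].
rewrite submxcol_mulmx (bigD1 i) //= big1 ?addr0 // => j ji.
by rewrite Bd ?mul0mx // eq_sym.
Qed.

Lemma submxblock_unitmx B i : is_diag_mx B -> (forall r, B r r != 0) ->
  submxblock B i i \in unitmx.
Proof.
by move=> Bd B0; apply: diag_unitmx => [|r]; rewrite ?mxE //; apply: diag_submxblock.
Qed.

Lemma submxcol_invmx_mulmx B y i : is_diag_mx B -> (forall r, B r r != 0) ->
  submxcol (invmx B *m y) i = invmx (submxblock B i i) *m submxcol y i.
Proof.
move=> Bd B0; have Bu := submxblock_unitmx i Bd B0.
by rewrite -[LHS](mulKmx Bu) -submxcol_diag_mulmx // mulKVmx // diag_unitmx.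
Qed.

Lemma structuredD (S : 'M[nat]_q) A B :
  structured S A -> structured S B -> structured S (A + B).
Proof.
by move=> SA SB i j Sij; rewrite submxblockD SA // SB // addr0.
Qed.

Lemma structured_delta (e : rel 'I_q) (a : R) i j r s : e j i ->
  structured (nb := nb) (adjacency e)
    (a *: delta_mx (tagnat.Rank i r) (tagnat.Rank j s)).
Proof.
move=> eji i' j'; rewrite mxE => /eqP; rewrite eqb0 => ne.
apply/matrixP => k l; rewrite !mxE -!val_eqE /= !tagnat.eq_Rank.
case: (eqVneq i' i) => [ii'|] /=; last by rewrite mulr0.
case: (eqVneq j' j) => [jj'|] /=; last by rewrite ?andbF mulr0.
by case/negP: ne; rewrite ii' jj'.
Qed.

End Blocks.

Lemma one_step_cost_attained (R : realType) k (B : 'M[R]_k) (y : 'cV_k) :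
  is_diag_mx B -> exists u, sqnorm (y + B *m u) + sqnorm u = one_step_cost B y.
Proof.
(* The zero of the square found in [one_step_cost_le]. *)
move=> Bd; exists (\col_i (- B i i * y i 0 / (1 + B i i ^+ 2))).
rewrite !sqnormE -big_split; apply: eq_bigr => i _ /=.
rewrite [(y + _) _ _]mxE diag_mulmx // !mxE; field.
by rewrite gt_eqF // ltr_wpDr ?sqr_ge0.
Qed.

(** * Cost of the design method *)

Section ThetaUpperBound.
Context {R : realType} {m c : nat} {nb : 'I_(m + c) -> nat}.
Local Notation n := (\sum_(i < m + c) nb i)%N.
Context {e : rel 'I_(m + c)}.
Hypothesis sinkE : forall i, sink e i = (m <= i)%N.
Variables (A B : 'M[R]_n).
Hypothesis SA : structured (adjacency e) A.
Hypothesis Bd : is_diag_mx B.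
Hypothesis B0 : forall r, B r r != 0.
Implicit Types x : 'cV[R]_n.

(** Block (i, j) of A belongs to the edge from j to i, and a sink j has no edge to another
    vertex. *)
Lemma sink_column (i j : 'I_(m + c)) : (m <= j)%N -> i != j -> submxblock A i j = 0.
Proof.
rewrite -sinkE => /forallP/(_ i)/implyP ej ij; apply: SA.
by rewrite mxE; apply/eqP; rewrite eqb0 ej.
Qed.

Let X i := riccati_sol (submxblock A i i) (submxblock B i i).

Lemma riccati_sol_submxblock i : posdef (X i) /\
  riccati (submxblock A i i) (submxblock B i i) (X i).
Proof. exact/riccati_solP/submxblock_unitmx. Qed.

Lemma submxcol_Theta_mulmx x i :
  submxcol (Theta A B *m x) i = - (Theta_block A B i *m submxcol (A *m x) i).
Proof.
rewrite /Theta mulNmx submxcolN -mulmxA -[A *m x in LHS]submxcolK.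
by rewrite mul_mxdiag_mxcol mxcolK.
Qed.

Lemma submxcol_Theta_closed_loop x0 x i :
  submxcol (closed_loop (Plant A B x0) (Theta A B) x) i =
  submxcol (A *m x) i
  + submxblock B i i *m - (Theta_block A B i *m submxcol (A *m x) i).
Proof.
rewrite /closed_loop submxcolD (submxcol_diag_mulmx _ _ Bd).
by rewrite submxcol_Theta_mulmx.
Qed.

Lemma Theta_closed_loop_nonsink x0 x (i : 'I_(m + c)) : (i < m)%N ->
  submxcol (closed_loop (Plant A B x0) (Theta A B) x) i = 0.
Proof.
move=> im; rewrite submxcol_Theta_closed_loop /Theta_block im mulmxN.
by rewrite mulKVmx ?subrr // submxblock_unitmx.
Qed.

(** With y the i-th block of A x: deadbeat energy on a non-sink, optimal cost of the isolated
    subsystem on a sink. *)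
Definition Theta_cost_block i (y : 'cV[R]_(nb i)) :=
  if (i < m)%N then sqnorm (invmx (submxblock B i i) *m y)
  else qform (rstep (submxblock B i i) (X i)) y.

Definition Theta_cost x := \sum_i Theta_cost_block (submxcol (A *m x) i).

Lemma Theta_cost_block_ge0 i (y : 'cV_(nb i)) : 0 <= Theta_cost_block y.
Proof.
rewrite /Theta_cost_block; case: ifP => _; first exact: sqnorm_ge0.
have [/posdef_psd pX _] := riccati_sol_submxblock i.
exact: (psd_rstep _ pX).2.
Qed.

(** [Theta_cost] is a Lyapunov function, and the decrease can be checked block by block. *)
Lemma cost_Theta_le x0 :
  (cost (Plant A B x0) (Theta A B) <= (Theta_cost x0)%:E)%E.
Proof.
pose P := Plant A B x0; apply: (@cost_le_lyapunov _ _ _ P) => x.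
  by apply: sumr_ge0 => i _; apply: Theta_cost_block_ge0.
rewrite 2!sqnorm_submxcol -!big_split /=; apply: ler_sum => i _.
set x' := closed_loop _ _ x; rewrite submxcol_Theta_mulmx sqnormN.
have x'0 (j : 'I_(m + c)) : (j < m)%N -> submxcol x' j = 0.
  exact: Theta_closed_loop_nonsink.
(* Decoupling after one step: non-sink blocks of x' vanish, and sinks act only on themselves. *)
have -> : submxcol (A *m x') i = submxblock A i i *m submxcol x' i.
  rewrite submxcol_mulmx (bigD1 i) //= big1 ?addr0 // => j ji.
  have [jm|mj] := ltnP j m; first by rewrite x'0 // mulmx0.
  by rewrite sink_column ?mul0mx // eq_sym.
have [im|mi] := ltnP i m.
  rewrite x'0 // sqnorm0 add0r /Theta_block /Theta_cost_block im !mulmx0 sqnorm0.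
  by rewrite addr0.
have [/posdef_psd pX rX] := riccati_sol_submxblock i.
rewrite /Theta_cost_block ltnNge mi /= addrAC -(riccati_qform _ rX).
rewrite /x' submxcol_Theta_closed_loop /Theta_block ltnNge mi /=.
by rewrite -(stage_gain _ _ pX) /stage sqnormN addrC.
Qed.

Lemma Theta_cost_le_deadbeat x : Theta_cost x <= sqnorm (invmx B *m (A *m x)).
Proof.
rewrite sqnorm_submxcol; apply: ler_sum => i _.
rewrite submxcol_invmx_mulmx // /Theta_cost_block; case: ifP => // _.
have [/posdef_psd pX _] := riccati_sol_submxblock i.
by apply: rstep_le_deadbeat => //; apply: submxblock_unitmx.
Qed.

(** Non-sink blocks of A x vanish; on a sink A_ii = 0 turns the Riccati equation into X_ii = I, so
    the cost there is the one-step minimum. *)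
Lemma Theta_cost_le_one_step x :
  (forall i j : 'I_(m + c), (i < m)%N -> (j < m)%N -> submxblock A i j = 0) ->
  (forall i : 'I_(m + c), (m <= i)%N -> submxblock A i i = 0) ->
  Theta_cost x <= one_step_cost B (A *m x).
Proof.
move=> A11 A22; have [u <-] := one_step_cost_attained (A *m x) Bd.
rewrite !sqnorm_submxcol -big_split /=; apply: ler_sum => i _.
rewrite submxcolD (submxcol_diag_mulmx _ _ Bd) /Theta_cost_block.
have [im|mi] := ltnP i m.
  suff -> : submxcol (A *m x) i = 0.
    by rewrite mulmx0 sqnorm0 addr_ge0 ?sqnorm_ge0.
  rewrite submxcol_mulmx big1 // => j _.
  have [jm|mj] := ltnP j m; first by rewrite A11 ?mul0mx.
  rewrite sink_column ?mul0mx //.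
  by apply: contraTneq im => ->; rewrite -leqNgt.
have [/posdef_psd pX /riccatiP] := riccati_sol_submxblock i.
rewrite A22 // mulmx0 addr0 => X1.
apply: le_trans (rstep_le_stage _ _ (submxcol u i) pX) _.
by rewrite /stage X1 qform1 addrC.
Qed.

End ThetaUpperBound.

(** * Plants approaching the bound *)

Section DeltaVectors.
Context {R : realType} {k : nat}.
Implicit Types (x : 'cV[R]_k) (p r : 'I_k).
Local Notation dl p := (delta_mx p 0 : 'cV[R]_k).

Lemma delta_mulmx p r x : delta_mx p r *m x = x r 0 *: dl p.
Proof.
apply/colP => i; rewrite !mxE (bigD1 r) //= big1 ?addr0 => [|j jr].
  by rewrite !mxE eqxx !andbT mulrC.
by rewrite mxE (negPf jr) andbF mul0r.
Qed.

Lemma sqnorm_delta p : sqnorm (dl p) = 1.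
Proof.
rewrite sqnormE (bigD1 p) //= big1 ?addr0 => [|j jp]; first by rewrite mxE !eqxx expr1n.
by rewrite mxE (negPf jp) expr0n.
Qed.

Lemma sqnorm_delta2 p r (a b : R) : p != r ->
  sqnorm (a *: dl p + b *: dl r) = a ^+ 2 + b ^+ 2.
Proof.
move=> pr; rewrite sqnormE (bigD1 p) //= (bigD1 r) 1?eq_sym //= big1 ?addr0.
  by rewrite !mxE !eqxx (negPf pr) eq_sym (negPf pr) !mulr0 !mulr1 addr0 add0r.
by move=> j /andP[jp jr]; rewrite !mxE (negPf jp) (negPf jr) !mulr0 addr0 expr0n.
Qed.

Lemma sqr_le_sqnorm x p : x p 0 ^+ 2 <= sqnorm x.
Proof. by rewrite sqnormE (bigD1 p) //= lerDl sumr_ge0 // => i _; rewrite sqr_ge0. Qed.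

Lemma one_step_cost_scalar (b : R) x :
  one_step_cost b%:M x = sqnorm x / (1 + b ^+ 2).
Proof.
rewrite sqnormE mulr_suml; apply: eq_bigr => i _.
by rewrite mxE eqxx.
Qed.

End DeltaVectors.

Section ThetaLowerBound.
Context {R : realType} {m c : nat} {nb : 'I_(m + c) -> nat}.
Local Notation n := (\sum_(i < m + c) nb i)%N.
Context {e eK : rel 'I_(m + c)} {eps : R}.
Hypothesis eps_gt0 : 0 < eps.
Hypothesis eKc : complete_graph eK.
Implicit Types x : 'cV[R]_n.

Let B : 'M[R]_n := eps%:M.
Let ratio := competitive_ratio (adjacency e) (adjacency eK) eps (@Theta R m c nb).

Let Bd : is_diag_mx B. Proof. exact: scalar_mx_is_diag. Qed.

Let B0 r : B r r != 0. Proof. by rewrite mxE eqxx gt_eqF. Qed.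

(** Any gain K bounds the optimum from above, and a single plant bounds the supremum from below. *)
Lemma competitive_ratio_ge A x (K : 'M[R]_n) (lo hi : R) :
  structured (adjacency e) A -> 0 < lo -> 0 < hi ->
  (lo%:E <= cost (Plant A B x) (Theta A B))%E ->
  (cost (Plant A B x) K <= hi%:E)%E -> ((lo / hi)%:E <= ratio)%E.
Proof.
move=> SA lo0 hi0 loT Khi; pose P := Plant A B x.
apply: (@le_trans _ _
  (cost_ratio (cost P (Theta A B)) (cost P (Kstar (adjacency eK) P)))).
  apply: cost_ratio_ge => //; first exact: cost_ge0.
  by apply: le_trans Khi; apply: cost_Kstar_le => //; apply: diag_unitmx.
apply: ereal_sup_ubound; exists P => //; split=> //; split=> // i.
by rewrite mxE eqxx.
Qed.

Lemma Theta_closed_loop_nonsink_entry A x0 x (i : 'I_(m + c)) r : (i < m)%N ->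
  closed_loop (Plant A B x0) (Theta A B) x (tagnat.Rank i r) 0 = 0.
Proof.
move=> im; have := Theta_closed_loop_nonsink A Bd B0 x0 x im.
by move=> /matrixP/(_ r 0); rewrite !mxE.
Qed.

Lemma ratio_ge_nonsink_edge (i j : 'I_(m + c)) :
  (0 < nb i)%N -> (0 < nb j)%N -> (i < m)%N -> e j i ->
  ((1 + 1 / eps ^+ 2)%:E <= ratio)%E.
Proof.
move=> nbi nbj im eji; pose r := tagnat.Rank i (Ordinal nbi).
pose s := tagnat.Rank j (Ordinal nbj).
have e2 : 0 < eps ^+ 2 by rewrite exprn_gt0.
apply: (@le_of_linear_error _ _ _ 1) => //.
  by rewrite addr_ge0 // divr_ge0 // ltW.
move=> h /andP[h0 h1].
have [A SA Ax] : exists2 A : 'M[R]_n, structured (adjacency e) A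
    & forall x, A *m x = (h * x s 0) *: delta_mx r 0.
  exists (h *: delta_mx r s) => [|x]; first exact: structured_delta.
  by rewrite -scalemxAl delta_mulmx scalerA.
(* The one-step optimal gain for B = eps I. *)
pose K : 'M[R]_n := - (eps / (1 + eps ^+ 2)) *: A.
(* Sum of the geometric series with first term h^2/(1 + eps^2) and ratio h^2: a stage costs at most
   that term times |x|^2, and |x|^2 shrinks by at least the factor h^2. This also covers a
   self-loop, r = s. *)
pose d := h ^+ 2 / ((1 + eps ^+ 2) * (1 - h ^+ 2)).
pose x0 : 'cV[R]_n := delta_mx s 0.
have h21 : h ^+ 2 < 1 by rewrite expr_lt1 // ltW.
have h2 : 0 < h ^+ 2 by rewrite exprn_gt0.
have d0 : 0 < d by rewrite divr_gt0 // mulr_gt0 ?subr_gt0 // addr_gt0.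
have loT : ((h ^+ 2 / eps ^+ 2)%:E <= cost (Plant A B x0) (Theta A B))%E.
  apply: le_trans (cost_ge_sum _ _ 1); rewrite big_ord1 lee_fin.
  apply: (@le_trans _ _ (sqnorm (input (Plant A B x0) (Theta A B) 0))).
    apply: le_trans (sqr_le_sqnorm _ r).
    (* Deadbeat at r forces the input -h/eps there. *)
    have : (A *m x0 + B *m (Theta A B *m x0)) r 0 = 0.
      exact: (Theta_closed_loop_nonsink_entry A x0 x0 (Ordinal nbi) im).
    rewrite mxE (diag_mulmx _ _ Bd) Ax ![in X in X + _]mxE !eqxx !mulr1 /input /=.
    rewrite [B r r]mxE eqxx /=; move: ((_ *m _) r 0) => u hu.
    have -> : u = - h / eps.
      apply: (mulfI (lt0r_neq0 eps_gt0)).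
      by rewrite mulrCA divff ?gt_eqF // mulr1; lra.
    by rewrite expr_div_n sqrrN.
  by rewrite lerDr sqnorm_ge0.
have Khi : (cost (Plant A B x0) K <= d%:E)%E.
  have -> : d = d * sqnorm x0 by rewrite sqnorm_delta mulr1.
  apply: (@cost_le_lyapunov _ _ _ (Plant A B x0) K (fun x => d * sqnorm x)) => x.
    by rewrite mulr_ge0 ?sqnorm_ge0 // ltW.
  have -> : K *m x = - (eps / (1 + eps ^+ 2)) *: (A *m x).
    by rewrite /K -scalemxAl.
  have -> : closed_loop (Plant A B x0) K x = (1 + eps ^+ 2)^-1 *: (A *m x).
    rewrite /closed_loop /K /= -scalemxAl mul_scalar_mx scalerA.
    rewrite -{1}[A *m x]scale1r -scalerDl; congr (_ *: _); field.
    by rewrite gt_eqF // addr_gt0.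
  rewrite !sqnormZ.
  have : sqnorm (A *m x) <= h ^+ 2 * sqnorm x.
    by rewrite Ax sqnormZ sqnorm_delta mulr1 exprMn ler_wpM2l ?sqr_ge0 ?sqr_le_sqnorm.
  move: (sqnorm (A *m x)) (sqnorm x) (sqnorm_ge0 x) => a b b0 ab.
  set E := 1 + eps ^+ 2; have E1 : 1 < E by rewrite ltrDl.
  have E0 : 0 < E by rewrite (lt_trans ltr01).
  have dE : d * E = h ^+ 2 + d * E * h ^+ 2.
    by rewrite /d -/E; field; rewrite !gt_eqF // subr_gt0.
  have -> : E^-1 ^+ 2 * a + (- (eps / E)) ^+ 2 * a + d * (E^-1 ^+ 2 * a)
            = (E + d) / E ^+ 2 * a.
    rewrite sqrrN expr_div_n (_ : eps ^+ 2 = E - 1); last by rewrite /E; ring.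
    by field; rewrite gt_eqF.
  apply: (@le_trans _ _ ((E + d) / E ^+ 2 * (h ^+ 2 * b))).
    by rewrite ler_wpM2l // divr_ge0 ?addr_ge0 ?sqr_ge0 // ltW.
  rewrite mulrA ler_wpM2r //.
  rewrite mulrAC ler_pdivrMr ?exprn_gt0 //.
  (* The slack: the next squared norm was counted as h^2 |x|^2, although it is at most (h/E)^2
     |x|^2. *)
  have : 0 <= (E ^+ 2 - 1) * (d * h ^+ 2).
    apply: mulr_ge0; first by rewrite subr_ge0 exprn_ege1 // ltW.
    by rewrite mulr_ge0 // ltW.
  have : d * E ^+ 2 = E * h ^+ 2 + d * E ^+ 2 * h ^+ 2.
    by rewrite expr2 mulrA {1}dE; ring.
  by lra.
apply: le_trans (competitive_ratio_ge SA _ d0 loT Khi); last by rewrite divr_gt0.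
rewrite lee_fin /d.
have -> : h ^+ 2 / eps ^+ 2 / (h ^+ 2 / ((1 + eps ^+ 2) * (1 - h ^+ 2))) =
   (1 + 1 / eps ^+ 2) * (1 - h ^+ 2).
  by field; rewrite !gt_eqF ?subr_gt0 // addr_gt0.
apply: ler_wpM2l; first by rewrite addr_ge0 // divr_ge0 // ltW.
by rewrite mul1r lerD2l lerN2 expr2 ger_pMl // ltW.
Qed.

(** Deadbeat at j leaves x1 zero at s, so any remaining entry at r is amplified by a at the next
    step; the competitor uses s to cancel it. *)
Lemma ratio_ge_sink_loop (i j : 'I_(m + c)) :
  (0 < nb i)%N -> (0 < nb j)%N -> (j < m)%N -> i != j -> e i i -> e j i ->
  ((1 + 1 / eps ^+ 2)%:E <= ratio)%E.
Proof.
move=> nbi nbj jm ij eii eji; pose r := tagnat.Rank i (Ordinal nbi).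
pose s := tagnat.Rank j (Ordinal nbj).
have rs : r != s by rewrite -val_eqE /= tagnat.eq_Rank (negPf ij).
have e2 : 0 < eps ^+ 2 by rewrite exprn_gt0.
set C := 1 + _; have C0 : 0 < C by rewrite addr_gt0 // divr_gt0.
(* The slope 2 C comes from (1 - 2z)(1 + z)^2 <= 1 with z = C h. *)
apply: (@le_of_linear_error _ _ _ (2 * C)); [exact: ltW|by rewrite mulr_gt0|].
move=> h /andP[h0 h1]; pose a := h^-1; have a0 : 0 < a by rewrite invr_gt0.
have [A SA Ax] : exists2 A : 'M[R]_n, structured (adjacency e) A
    & forall x, A *m x = (a * x r 0 + a ^+ 2 * x s 0) *: delta_mx r 0.
  exists (a *: delta_mx r r + a ^+ 2 *: delta_mx r s) => [|x].
    by apply: structuredD; exact: structured_delta.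
  by rewrite mulmxDl -!scalemxAl !delta_mulmx !scalerA scalerDl.
pose E := 1 + eps ^+ 2; have E1 : 1 < E by rewrite ltrDl.
have E0 : 0 < E by rewrite (lt_trans ltr01).
pose x0 : 'cV[R]_n := delta_mx s 0.
have Ax0 : A *m x0 = a ^+ 2 *: delta_mx r 0.
  by rewrite Ax !mxE !eqxx (negPf rs) /= mulr0 add0r mulr1.
pose P := Plant A B x0.
(* The minimum over u of u^2 + a^2 x^2/E with x = a^2 + eps u; the term x^2 of the first stage is
   dropped. *)
pose lo := a ^+ 4 / (E * h ^+ 2 + eps ^+ 2).
pose hi := a ^+ 4 * ((1 + h ^+ 2 / eps ^+ 2) / E).
have loT : (lo%:E <= cost P (Theta A B))%E.
  apply: le_trans (cost_ge_sum _ _ 2); rewrite lee_fin big_ord_recr big_ord1 /=.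
  set x1 := state P (Theta A B) 1; set u0 := input P (Theta A B) 0.
  have x1s : x1 s 0 = 0.
    exact: (Theta_closed_loop_nonsink_entry A x0 x0 (Ordinal nbj) jm).
  have x1r : x1 r 0 = a ^+ 2 + eps * u0 r 0.
    rewrite /x1 /= -/u0 mxE (diag_mulmx _ _ Bd) Ax0 ![in X in X + _]mxE !eqxx.
    by rewrite mulr1 [B r r]mxE eqxx.
  have g0 : x1 r 0 ^+ 2 + u0 r 0 ^+ 2 <= stage_cost P (Theta A B) 0.
    by rewrite lerD // sqr_le_sqnorm.
  have g1 : a ^+ 2 * x1 r 0 ^+ 2 / E <= stage_cost P (Theta A B) 1.
    apply: le_trans (one_step_cost_le_stage (P := P) _ 1 Bd).
    rewrite one_step_cost_scalar -/x1 Ax x1s mulr0 addr0 sqnormZ sqnorm_delta.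
    by rewrite mulr1 exprMn.
  apply: le_trans (lerD g0 g1); rewrite x1r; move: (u0 r 0) => u.
  have D0 : 0 < E * h ^+ 2 + eps ^+ 2 by rewrite addr_gt0 // mulr_gt0 // exprn_gt0.
  rewrite /lo ler_pdivrMr // -subr_ge0.
  set x := a ^+ 2 + eps * u.
  (* Lagrange's identity for the Cauchy-Schwarz bound on x - eps u = a^2. *)
  have -> : (x ^+ 2 + u ^+ 2 + a ^+ 2 * x ^+ 2 / E) * (E * h ^+ 2 + eps ^+ 2)
      - a ^+ 4 = (E * h ^+ 2 + eps ^+ 2) * x ^+ 2
                 + (eps * a * x + E * h * u) ^+ 2 / E.
    by rewrite /x /a; field; rewrite !gt_eqF.
  apply: addr_ge0; first exact: mulr_ge0 (ltW D0) (sqr_ge0 _).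
  exact: divr_ge0 (sqr_ge0 _) (ltW E0).
(* One-step optimal input at r, plus an input of order h at s, chosen so that A annihilates the next
   state. *)
pose K : 'M[R]_n := - (eps / E) *: A - (h / (eps * E)) *: (delta_mx s r *m A).
have Khi : (cost P K <= hi%:E)%E.
  pose w := (1 + h ^+ 2 / eps ^+ 2) / E.
  have -> : hi = w * sqnorm (A *m x0).
    by rewrite Ax0 sqnormZ sqnorm_delta mulr1 -exprM mulrC.
  apply: (@cost_le_lyapunov _ _ _ P K (fun x => w * sqnorm (A *m x))) => x.
    by rewrite mulr_ge0 ?sqnorm_ge0 // divr_ge0 ?addr_ge0 ?divr_ge0 ?sqr_ge0 // ltW.
  set t := a * x r 0 + a ^+ 2 * x s 0.
  have Kx : K *m x = (- (eps / E * t)) *: delta_mx r 0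
                     + (- (h / (eps * E) * t)) *: delta_mx s 0.
    rewrite /K mulmxBl -!scalemxAl -mulmxA Ax delta_mulmx -/t !mxE !eqxx mulr1.
    by rewrite !scalerA mulNr !scaleNr.
  have clx : closed_loop P K x = (t / E) *: delta_mx r 0
                     + (- (h / E * t)) *: delta_mx s 0.
    rewrite /closed_loop /= Ax -/t Kx mul_scalar_mx scalerDr !scalerA addrA -scalerDl.
    by congr (_ *: _ + _ *: _); rewrite /E; field; rewrite !gt_eqF.
  rewrite clx Kx !sqnorm_delta2 //.
  have -> : A *m ((t / E) *: delta_mx r 0 + (- (h / E * t)) *: delta_mx s 0 : 'cV_n) = 0.
    rewrite Ax (_ : a * _ + _ = 0) ?scale0r //.
    rewrite !mxE !eqxx (eq_sym s) (negPf rs) /= /a; field.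
    by rewrite !gt_eqF.
  rewrite sqnorm0 mulr0 addr0 Ax -/t sqnormZ sqnorm_delta mulr1 le_eqVlt.
  apply/orP; left; apply/eqP.
  rewrite /w /E; field.
  by rewrite !gt_eqF // addr_gt0.
apply: le_trans (competitive_ratio_ge SA _ _ loT Khi).
- rewrite lee_fin.
  have g0 : 0 <= h ^+ 2 / eps ^+ 2 by rewrite divr_ge0 ?sqr_ge0.
  have gz : h ^+ 2 / eps ^+ 2 <= C * h.
    apply: (@le_trans _ _ (C * h ^+ 2)); last first.
      by rewrite ler_pM2l // expr2 ger_pMl // ltW.
    rewrite mulrC; apply: ler_wpM2r; first exact: sqr_ge0.
    by rewrite /C div1r lerDr.
  have z0 : 0 <= C * h by rewrite mulr_ge0 // ltW.
  have Cz : C * h ^+ 2 <= C * h by rewrite ler_pM2l // expr2 ger_pMl // ltW.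
  have C2 : 0 <= C * h ^+ 2 by rewrite mulr_ge0 ?sqr_ge0 // ltW.
  (* Both factors of the denominator are at most 1 + C h. *)
  have -> : lo / hi = C / ((1 + C * h ^+ 2) * (1 + h ^+ 2 / eps ^+ 2)).
    rewrite /lo /hi /C /E /a; field.
    by rewrite !gt_eqF // ?addr_gt0 // ?mulr_gt0 // ?addr_gt0.
  rewrite ler_pdivlMr ?mulr_gt0 // ?ltr_wpDr // -mulrA ger_pMr //.
  rewrite -(mulrA 2); move: (C * h) (C * h ^+ 2) (h ^+ 2 / _) z0 Cz gz C2 g0.
  move=> z v w z0 vz wz v0 w0.
  have [z1|z1] := lerP (1 - 2 * z) 0.
    by apply: (le_trans _ ler01); rewrite mulr_le0_ge0 // mulr_ge0 // addr_ge0.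
  apply: (@le_trans _ _ ((1 - 2 * z) * ((1 + z) * (1 + z)))).
    by rewrite ler_pM2l // ler_pM ?addr_ge0 ?lerD2l.
  have : 0 <= z * z by rewrite mulr_ge0.
  have : 0 <= z * z * z by rewrite !mulr_ge0.
  lra.
- rewrite divr_gt0 ?exprn_gt0 // addr_gt0 // mulr_gt0 // exprn_gt0 //.
- rewrite mulr_gt0 ?exprn_gt0 // divr_gt0 // ltr_wpDr // divr_ge0 // ?sqr_ge0 //.
Qed.

End ThetaLowerBound.

(** * Combining the upper and lower bounds *)

Theorem theorem3p18 (R : realType) (m c : nat) (nb : 'I_(m + c) -> nat)
    (eps : R) (eP eK : rel 'I_(m + c)) :
  (forall i, (0 < nb i)%N) ->
  0 < eps ->
  (1 <= c)%N ->
  (forall i, sink eP i = (m <= i)%N) ->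
  (forall i, ~~ isolated_vertex eP i) ->
  complete_graph eK ->
  competitive_ratio (adjacency eP) (adjacency eK) eps (@Theta R m c nb)
  = if (ulsubmx (adjacency eP) == 0) && (drsubmx (adjacency eP) == 0)
    then 1%E else (1 + 1 / eps ^+ 2)%:E.
Proof.
move=> nb0 eps0 _ sinkE noniso eKc.
have C1 : 1 <= 1 + 1 / eps ^+ 2 by rewrite lerDl divr_ge0 ?sqr_ge0.
(* Used with C = 1 in the degenerate case and C = 1 + 1/eps^2 otherwise. *)
have upper C : 1 <= C ->
    (forall A B x, structured (adjacency eP) A -> input_matrix (nb := nb) eps B ->
       Theta_cost A B x <= C * one_step_cost B (A *m x)) ->
    (competitive_ratio (adjacency eP) (adjacency eK) eps (@Theta R m c nb)
     <= C%:E)%E.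
  move=> C1' le_one; apply: ge_ereal_sup => _ [[A B x] [/= SA [Bd Be]] <-].
  have B0 r : B r r != 0 by rewrite gt_eqF // (lt_le_trans eps0).
  apply: (@cost_ratio_le _ _ _ _ (one_step_cost B (A *m x))) => //.
  - exact: one_step_cost_ge0.
  - exact: cost_ge0.
  - apply: le_trans (cost_Theta_le sinkE SA Bd B0 x) _.
    by rewrite lee_fin le_one.
  - exact: (@one_step_cost_le_cost _ _ _ (Plant A B x)).
have entry0 i j (A : 'M[R]_(\sum_(i < m + c) nb i)) :
    ~~ eP j i -> structured (nb := nb) (adjacency eP) A ->
    submxblock A i j = 0.
  by move=> ne SA; apply: SA; rewrite mxE; apply/eqP; rewrite eqb0.
case: ifPn => [/andP[/eqP S11 /eqP S22]|].
  apply/eqP; rewrite eq_le; apply/andP; split.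
    apply: upper => // A B x SA [Bd Be]; rewrite mul1r.
    have B0 r : B r r != 0 by rewrite gt_eqF // (lt_le_trans eps0).
    apply: (Theta_cost_le_one_step sinkE SA Bd B0) => [i j im jm|i mi].
      apply: entry0 => //; rewrite -eqb0; apply/eqP.
      have := congr1 (fun M : 'M[nat]_(m, m) => M (Ordinal im) (Ordinal jm)) S11.
      by rewrite !mxE; congr (nat_of_bool (eP _ _) = _); apply: val_inj.
    have im : (i - m < c)%N by rewrite ltn_subLR.
    apply: entry0 => //; rewrite -eqb0; apply/eqP.
    have := congr1 (fun M : 'M[nat]_(c, c) => M (Ordinal im) (Ordinal im)) S22.
    rewrite !mxE; congr (nat_of_bool (eP _ _) = _); apply: val_inj => /=;
      by rewrite subnKC.
  (* The value 1 is attained by the zero plant, through the convention 0/0 = 1. *)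
  apply: ereal_sup_ubound; exists (Plant 0 eps%:M 0) => /=.
    split=> [i j _|]; first by rewrite submxblock0.
    by split=> [|i]; rewrite ?scalar_mx_is_diag // mxE eqxx.
  have cost0 K : cost (Plant (nb := nb) 0 eps%:M 0) K = 0%E.
    have st0 t : state (Plant (nb := nb) 0 eps%:M 0) K t = 0.
      by elim: t => //= t ->; rewrite !mulmx0 addr0.
    rewrite costE eseries0 // => t _ _.
    by rewrite /stage_cost /input !st0 mulmx0 sqnorm0 addr0.
  by rewrite !cost0 /cost_ratio eqxx.
move=> nontriv; apply/eqP; rewrite eq_le; apply/andP; split.
  apply: upper => // A B x SA [Bd Be].
  have B0 r : B r r != 0 by rewrite gt_eqF // (lt_le_trans eps0).
apply: le_trans (Theta_cost_le_deadbeat A Bd B0 x) _. exact: deadbeat_le.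
move: nontriv; rewrite negb_and => /orP[] /matrix0Pn[i [j]]; rewrite !mxE eqb0 negbK.
  by move=> eji; apply: (ratio_ge_nonsink_edge eps0 eKc _ _ _ eji) => /=.
set i' := rshift m i; set j' := rshift m j => eji.
have mj : sink eP j' by rewrite sinkE leq_addr.
(* A nonzero entry of the sink block is a self-loop, since a sink has no edge to another vertex. *)
have ij : i' = j'.
  by apply: contraTeq eji => ne; move/forallP/(_ i')/implyP: mj; apply.
(* The sink is not isolated, so some other vertex l points to it; having an outgoing edge, l is a
   non-sink. *)
have := noniso j'; rewrite negb_forall => /existsP[l].
rewrite negb_imply negb_and !negbK => /andP[lj /orP[ejl|elj]].
  by move/forallP/(_ l)/implyP/(_ lj)/negP: mj.
apply: (@ratio_ge_sink_loop _ _ _ _ _ _ _ eps0 eKc j' l) => //.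
- rewrite ltnNge -sinkE; apply/negP => /forallP/(_ j')/implyP.
  by rewrite eq_sym elj => /(_ lj).
- by rewrite eq_sym.
- by rewrite -[X in eP _ X]ij.
Qed.
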